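(* Let $\Omega\subset\mathbb{R}$ be a bounded open interval, let $b\in\mathbb{R}\setminus\{0\}$ be constant, and let $f\in L_2(\Omega)$. Let $u\in L_2(\Omega)$ be the ultra-weak solution of the advection problem, i.e. $-(u, b\nabla v)=(f,v)$ for all $v\in H^1_+(\Omega)$. Then $$\|u-u_h\| = \|\mathcal{R}(u_h)\|_{b;\,H^1_+(\Omega)'}\qquad \forall\, u_h\in L_2(\Omega).$$
   Context: Notation: $(v,w)=\int_\Omega v w$ and $\|v\|=(v,v)^{1/2}$ is the $L_2(\Omega)$-norm; $\nabla v=v'$. With $n=\pm1$ the outward unit normal at the endpoints of $\Omega$, the inflow and outflow boundaries are $\partial_\pm\Omega=\{x\in\partial\Omega:\ \pm b\, n(x)>0\}$ ($-$ for inflow, $+$ for outflow), and $H^1_\pm(\Omega)=\{w\in H^1(\Omega):\ w=0 \text{ on } \partial_\pm\Omega\}$. The ultra-weak formulation is the weak form of $b\nabla u=f$ in $\Omega$, $u=0$ on $\partial_-\Omega$; it is well-posed. For $u_h\in L_2(\Omega)$ the residual $\mathcal{R}(u_h)\in H^1_+(\Omega)'$ is the bounded linear functional $$\langle\mathcal{R}(u_h),v\rangle=(f,v)+(u_h,b\nabla v),\qquad v\in H^1_+(\Omega),$$ and its velocity-scaled dual norm is $$\|\mathcal{R}(u_h)\|_{b;\,H^1_+(\Omega)'}=\sup_{v\in H^1_+(\Omega)\setminus\{0\}}\frac{\langle\mathcal{R}(u_h),v\rangle}{\|b\nabla v\|}.$$ *)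

(* Defs.v *)
From mathcomp Require Import all_boot all_order all_algebra.
From mathcomp Require Import all_classical all_reals all_analysis.

Set Implicit Arguments.
Unset Strict Implicit.
Unset Printing Implicit Defensive.
Import Order.TTheory GRing.Theory Num.Theory.
Import numFieldNormedType.Exports.
Local Open Scope classical_set_scope.
Local Open Scope ring_scope.

(* Throughout, the domain is the open interval Omega = ]l, r[. *)

Definition leb_on {R : realType} (l r : R) : {measure set (measurableTypeR R) -> \bar R} :=
  mrestr (@lebesgue_measure R) (measurable_itv `]l, r[).

(* Elements are representatives: Borel functions R -> R with finite L2 norm
   over ]l, r[.  Equality of classes is equality (leb_on l r)-almost everywhere;
   nothing below depends on the values outside ]l, r[. *)
Notation L2 l r := (LfunType (leb_on l r) (lee1n 2)).

Definition inner {R : realType} (l r : R) (v w : R -> R) : R :=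
  \int[leb_on l r]_x (v x * w x).

Definition normL2 {R : realType} (l r : R) (v : R -> R) : R :=
  Num.sqrt (inner l r v v).

Definition test_function {R : realType} (l r : R) (phi : R -> R) : Prop :=
  [/\ forall n x, derivable (derive1n n phi) x 1,
      compact (closure [set x | phi x != 0]) &
      closure [set x | phi x != 0] `<=` `]l, r[].

Definition weak_derivative {R : realType} (l r : R) (v g : R -> R) : Prop :=
  forall phi : R -> R, test_function l r phi ->
    inner l r v (derive1 phi) = - inner l r g phi.

(* An element of H^1(]l, r[) carries a representative of its weak gradient;
   the latter is unique almost everywhere, and is only used under integrals. *)
Record H1 {R : realType} (l r : R) := MkH1 {
  H1_fun :> L2 l r;
  grad : L2 l r;
  grad_weak : weak_derivative l r H1_fun grad }.

(* The boundary value at a point of [l, r] is the value of the continuous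
   representative. *)
Definition has_trace {R : realType} (l r : R) (v : R -> R) (x t : R) : Prop :=
  exists w : R -> R, [/\ {within `[l, r], continuous w},
    v = w %[ae leb_on l r] & w x = t].

(* Only meaningful at the two endpoints. *)
Definition normal {R : realType} (l r x : R) : R := if x == l then - 1 else 1.

Definition outflow {R : realType} (l r b : R) : set R :=
  [set x | [set l; r] x /\ 0 < b * normal l r x].

Definition H1_plus {R : realType} (l r b : R) : set (H1 l r) :=
  [set v : H1 l r | forall x, outflow l r b x -> has_trace l r v x 0].

Definition ultra_weak_solution {R : realType} (l r b : R) (f u : L2 l r)
    : Prop :=
  forall v : H1 l r, H1_plus b v -> - inner l r u (b *: grad v) = inner l r f v.

Definition residual {R : realType} (l r b : R) (f uh : L2 l r) (v : H1 l r) : R :=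
  inner l r f v + inner l r uh (b *: grad v).

(* The supremum is taken in \bar R, so it is never a junk value.  A quotient is
   never 0 / 0: a function of H1_plus with null gradient vanishes a.e. *)
Definition scaled_dual_norm {R : realType} (l r b : R) (F : H1 l r -> R) : \bar R :=
  ereal_sup [set (F v / normL2 l r (b *: grad v))%:E |
    v in [set v : H1 l r | H1_plus b v /\ ~ (v = cst 0 %[ae leb_on l r])]].

(* Main.v *)
Require Import Defs.
From mathcomp Require Import all_boot all_order all_algebra.
From mathcomp Require Import all_classical all_reals all_analysis.
From mathcomp Require Import measurable_realfun ring lra.
Import Order.TTheory GRing.Theory Num.Theory.
Import numFieldNormedType.Exports.
Set Implicit Arguments.
Unset Strict Implicit.
Unset Printing Implicit Defensive.
Local Open Scope classical_set_scope.
Local Open Scope ring_scope.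

(** The ultra-weak equation turns the residual into an inner product: for every
    test function v, <R(uh), v> = (uh - u, b v'). With e = uh - u, the
    Cauchy-Schwarz inequality ([cauchy_schwarz]) bounds every quotient of the
    dual norm by ||e||.

    The bound is attained because v |-> b v' maps H^1_+ onto L_2: the primitive
    of h / b that vanishes at the outflow point lies in H^1_+, and its scaled
    gradient is h ([H1_primitive]). The choice h = e gives the quotient ||e||.
    When ||e|| = 0 that choice is the zero test function, which the supremum
    excludes; any h of nonzero norm then gives the quotient 0 = ||e||, and the
    constant 1 is used.

    The work lies in the properties of x |-> \int_l^x g + c for g in L_2.
    It is bounded, hence in L_2, and continuous on [l, r], hence its own trace.
    Its weak derivative is g, because the order of integration can be exchanged
    over the triangle t <= x ([Rintegral_primitiveM]) and the inner integral of
    a derivative of a test function is explicit ([Rintegral_derive_test]).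
    Finally, if it vanishes almost everywhere, then by continuity it vanishes
    everywhere, and the Lebesgue differentiation theorem gives g = 0 almost
    everywhere ([primitive_ae_eq0]); so the test function built from a nonzero h
    is admissible. *)

(** * Integration against a restricted measure *)

Section restriction.
Context {d} {T : measurableType d} {R : realType}.
Variable mu : {measure set T -> \bar R}.
Local Open Scope ereal_scope.

Lemma ae_mrestr (D : set T) (mD : measurable D) (P : set T) :
  (\forall x \ae mrestr mu mD, P x) <-> (\forall x \ae mu, D x -> P x).
Proof.
split=> -[N [mN N0 PN]].
  exists (N `&` D); split => //; first exact: measurableI.
  by move=> x /= /not_implyP[Dx nPx]; split => //; exact: PN.
exists (N `|` ~` D); split; first exact/measurableU/measurableC.
  rewrite /= /mrestr setIUl setICl setU0.
  by apply: (subset_measure0 _ _ _ N0) => //; exact: measurableI.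
move=> x /= nPx; have [Dx|] := pselect (D x); last by right.
by left; apply: PN => /= /(_ Dx).
Qed.

(** The measure mu is the sum of its restrictions to D and to the complement
    of D; the integral of f \_ D against the second one vanishes, and against
    the first one f \_ D and f have the same integral. *)
Lemma ge0_integral_mrestr (D : set T) (mD : measurable D) (f : T -> \bar R) :
  measurable_fun setT f ->
  (forall x, 0 <= f x) ->
  \int[mrestr mu mD]_x f x = \int[mu]_(x in D) f x.
Proof.
move=> mf f0; have mCD := measurableC mD.
have fD0 x : 0 <= (f \_ D) x by rewrite patchE; case: ifP.
have mfD : measurable_fun setT (f \_ D).
  by apply/(measurable_restrictT _ mD); exact: measurable_funTS.
rewrite [RHS]integral_mkcond.
rewrite [RHS](eq_measure_integral (measure_add (mrestr mu mD) (mrestr mu mCD))).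
  rewrite ge0_integral_measure_add//.
  rewrite [X in _ + X](ge0_ae_eq_integral _ _ _ (g := cst 0))//.
  - rewrite integral0 adde0; apply: ge0_ae_eq_integral => //.
    by apply: (ae_mrestr _ _).2; apply: aeW => x Dx _; rewrite patchE mem_set.
  - by apply: (ae_mrestr _ _).2; apply: aeW => x Dx _; rewrite patchE memNset.
move=> A mA _; rewrite [RHS]measure_addE /= /mrestr -measureU.
- by rewrite -setIUr setUCr setIT.
- exact: measurableI.
- exact: measurableI.
- by rewrite setIACA setICr setI0.
Qed.

Lemma integral_mrestr (D : set T) (mD : measurable D) (f : T -> \bar R) :
  measurable_fun setT f ->
  \int[mrestr mu mD]_x f x = \int[mu]_(x in D) f x.
Proof.
move=> mf; rewrite [LHS]integralE [RHS]integralE; congr (_ - _).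
- by apply: ge0_integral_mrestr => //; exact: measurable_funepos.
- by apply: ge0_integral_mrestr => //; exact: measurable_funeneg.
Qed.

End restriction.

(** * Primitives with respect to a finite measure on the line *)

Section primitive.
Context {R : realType}.
Variable mu : {finite_measure set (measurableTypeR R) -> \bar R}.
Local Notation T := (measurableTypeR R).

Lemma integrable_prod (g psi : T -> R) :
  mu.-integrable setT (EFin \o g) -> mu.-integrable setT (EFin \o psi) ->
  (mu \x mu)%E.-integrable setT (fun z : T * T => (psi z.1 * g z.2)%:E).
Proof.
move=> ig ip.
have /measurable_EFinP mg := measurable_int _ ig.
have /measurable_EFinP mp := measurable_int _ ip.
apply/integrable12ltyP.
  by apply/measurable_EFinP/measurable_funM; exact: measurableT_comp.
have -> : (\int[mu]_x \int[mu]_y `|(psi x * g y)%:E| =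
    (\int[mu]_x `|(psi x)%:E|) * \int[mu]_y `|(g y)%:E|)%E.
  under eq_integral.
    move=> x _; under eq_integral do rewrite EFinM abseM.
    rewrite ge0_integralZl//; last exact/measurableT_comp/measurable_EFinP.
    over.
  rewrite ge0_integralZr ?integral_ge0//.
  exact/measurableT_comp/measurable_EFinP.
move/integrableP : ig => [_ ig]; move/integrableP : ip => [_ ip].
by rewrite lte_mul_pinfty ?integral_ge0// ge0_fin_numE// integral_ge0.
Qed.

(** Integrability of psi(x) g(t) over the triangle t <= x: what Fubini's theorem
    needs to exchange the order of integration in [Rintegral_primitiveM]. *)
Lemma integrable_triangle (g psi : T -> R) :
  mu.-integrable setT (EFin \o g) -> mu.-integrable setT (EFin \o psi) ->
  (mu \x mu)%E.-integrable setT
    (fun z : T * T => (psi z.1 * (g \_ `]-oo, z.1]) z.2)%:E).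
Proof.
move=> ig ip.
have /measurable_EFinP mg := measurable_int _ ig.
have /measurable_EFinP mp := measurable_int _ ip.
apply: le_integrable (integrable_prod ig ip) => //.
  apply/measurable_EFinP/measurable_funM; first exact: measurableT_comp.
  rewrite (_ : (fun _ => _) = fun z : T * T => if z.2 <= z.1 then g z.2 else 0).
    apply: measurable_fun_ifT => //; first exact: measurable_fun_ler.
    exact: measurableT_comp.
  by apply/funext => z; rewrite patchE mem_setE in_itv.
move=> z _; rewrite lee_fin !normrM ler_wpM2l// patchE.
by case: ifP => // _; rewrite normr0.
Qed.

Definition primitive (g : R -> R) (x : R) : R := \int[mu]_(t in `]-oo, x]) g t.

Lemma primitiveE g x : primitive g x = \int[mu]_t (g \_ `]-oo, x]) t.
Proof. exact: Rintegral_mkcond. Qed.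

Lemma integrable_patch (g : T -> R) (A : set T) : measurable A ->
  mu.-integrable setT (EFin \o g) -> mu.-integrable setT (EFin \o (g \_ A)).
Proof.
move=> mA ig; rewrite -restrict_EFin; apply/integrable_restrict => //.
by rewrite setTI; exact: integrableS ig.
Qed.

Lemma EFin_primitive g x : mu.-integrable setT (EFin \o g) ->
  (primitive g x)%:E = (\int[mu]_t ((g \_ `]-oo, x]) t)%:E)%E.
Proof.
move=> ig; rewrite primitiveE fineK//.
by apply: integrable_fin_num => //; exact: integrable_patch.
Qed.

(** A primitive is a partial integral of a function that is integrable for the
    product measure, namely [integrable_triangle] with psi = 1. *)
Lemma measurable_primitive g : mu.-integrable setT (EFin \o g) ->
  measurable_fun [set: T] (primitive g).
Proof.
move=> ig; apply/measurable_EFinP.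
have i1 : mu.-integrable setT (EFin \o cst 1).
  exact: finite_measure_integrable_cst.
have := measurable_fubini_F (integrable_triangle ig i1).
apply: eq_measurable_fun => x _; rewrite /fubini_F /= EFin_primitive//.
by apply: eq_integral => t _; rewrite mul1r.
Qed.

Lemma le_normr_Rintegral_setT (g : T -> R) (A : set T) : measurable A ->
  mu.-integrable setT (EFin \o g) ->
  `|\int[mu]_(t in A) g t| <= \int[mu]_t `|g t|.
Proof.
move=> mA ig; rewrite Rintegral_mkcond.
have igA := integrable_patch mA ig.
apply: (le_trans (le_normr_Rintegral _ igA)) => //.
apply: le_Rintegral => //.
- exact: (integrable_abse igA).
- exact: (integrable_abse ig).
- by move=> t _; rewrite patchE; case: ifP => // _; rewrite normr0.
Qed.

(** Both sides are the double integral of psi(x) g(t) over t <= x. This is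
    integration by parts for a g that is only integrable: if psi is the
    derivative of a test function, the inner integral on the right is minus
    that test function. *)
Lemma Rintegral_primitiveM g psi :
  mu.-integrable setT (EFin \o g) -> mu.-integrable setT (EFin \o psi) ->
  \int[mu]_x (primitive g x * psi x) =
  \int[mu]_t (g t * \int[mu]_(x in `[t, +oo[) psi x).
Proof.
move=> ig ip; congr fine.
transitivity (\int[mu]_x \int[mu]_t (psi x * (g \_ `]-oo, x]) t)%:E)%E.
  apply: eq_integral => x _.
  under eq_integral do rewrite EFinM.
  rewrite integralZl//; last exact: integrable_patch.
  by rewrite -EFin_primitive// -EFinM mulrC.
rewrite (Fubini (integrable_triangle ig ip)).
apply: eq_integral => t _.
rewrite EFinM Rintegral_mkcond fineK; last first.
  by apply: integrable_fin_num => //; exact: integrable_patch.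
rewrite -integralZl//; last exact: integrable_patch.
apply: eq_integral => x _; rewrite -EFinM !patchE !mem_setE !in_itv/= andbT.
by case: ifP => //; rewrite ?mulr0// mulrC.
Qed.

End primitive.

(** * Test functions *)

Section test_functions.
Context {R : realType}.

(** Since the support is a closed subset of ]l, r[, a test function vanishes
    near every point outside ]l, r[, endpoints included; so does its
    derivative. *)
Lemma test_functionP (l r : R) (phi : R -> R) : test_function l r phi ->
  [/\ continuous phi, forall x, derivable phi x 1, continuous (derive1 phi),
   forall x, x \notin `]l, r[ -> phi x = 0
   & forall x, x \notin `]l, r[ -> derive1 phi x = 0].
Proof.
move=> [dphi _ supp].
have cont (f : R -> R) : (forall x, derivable f x 1) -> continuous f.
  by move=> df x; exact/differentiable_continuous/derivable1_diffP.
have zero x : x \notin `]l, r[ -> \forall y \near x, phi y = 0.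
  move=> xlr; have /= : ~ closure [set x | phi x != 0] x.
    by move=> /supp; apply/negP.
  move/existsNP => [B /not_implyP[xB /set0P/negP]].
  rewrite negbK => /eqP B0.
  apply: filterS xB => y By; apply/eqP; rewrite -[_ == _]negbK; apply/negP => y0.
  by have : set0 y by rewrite -B0.
split.
- exact: cont (dphi 0).
- exact: dphi 0.
- exact: cont (dphi 1).
- by move=> x /zero; exact: nbhs_singleton.
- move=> x /zero x0; rewrite derive1E.
  have x0' : \forall y \near x, phi y = cst 0 y by [].
  by rewrite (near_eq_derive _ x0') derive_cst.
Qed.

End test_functions.

(** * Lebesgue measure on a bounded open interval *)

Section interval.
Context {R : realType}.
Variables l r : R.
Local Notation leb := (@lebesgue_measure R).
Local Notation mlr := (leb_on l r).
Local Notation T := (measurableTypeR R).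

Lemma lebesgue_itv_lty : (leb `]l, r[ < +oo)%E.
Proof. by rewrite lebesgue_measure_itv; case: ifP => // _; rewrite ltry. Qed.

(** The measure [leb_on l r], bundled with its finiteness; the two are equal as
    measures by conversion. *)
Definition fin_leb_on : {finite_measure set T -> \bar R} :=
  [the {finite_measure set T -> \bar R} of
    mfrestr (T := T) (measurable_itv `]l, r[) lebesgue_itv_lty].

Lemma fin_leb_onE : fin_leb_on = mlr :> {measure set T -> \bar R}.
Proof. by []. Qed.

Lemma Rintegral_leb_on (f : T -> R) : measurable_fun setT f ->
  \int[mlr]_x f x = \int[leb]_(x in `]l, r[) f x.
Proof. by move=> mf; congr fine; apply: integral_mrestr; exact/measurable_EFinP. Qed.

Lemma integrable_leb_on (f : T -> R) : measurable_fun setT f ->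
  mlr.-integrable setT (EFin \o f) <-> leb.-integrable `]l, r[ (EFin \o f).
Proof.
move=> mf; have mEf : measurable_fun setT (EFin \o f) by exact/measurable_EFinP.
have mabs : measurable_fun setT (abse \o (EFin \o f)) by exact: measurableT_comp.
have /= E := integral_mrestr leb (measurable_itv `]l, r[) mabs.
split=> /integrableP[_ fi]; apply/integrableP; split => //.
- exact: measurable_funTS.
- by rewrite -E.
- by rewrite E.
Qed.

Lemma Lfun2_integrable_leb_on (f : L2 l r) : mlr.-integrable setT (EFin \o f).
Proof.
apply/Lfun1_integrable; apply: (Lfun_subset12 _ (LfunP f)).
by have := fin_num_measure fin_leb_on _ measurableT.
Qed.

(** The formula holds for every real t, also outside ]l, r[: the derivative
    vanishes off ]l, r[, so the integral is the one over [t, M] for any M > r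
    with M > t, and the fundamental theorem of calculus applies to [t, M]. *)
Lemma Rintegral_derive_test phi t : test_function l r phi ->
  \int[mlr]_(x in `[t, +oo[) derive1 phi x = - phi t.
Proof.
move=> /test_functionP[cphi dphi cdphi phi0 dphi0].
have mdphi : measurable_fun [set: T] (derive1 phi).
  exact: continuous_measurable_fun.
pose M := Num.max t r + 1.
have tM : t < M by rewrite ltr_pwDr// le_max lexx.
have rM : r < M by rewrite ltr_pwDr// le_max lexx orbT.
have -> : - phi t = phi M - phi t.
  by rewrite (phi0 M) ?sub0r// in_itv/= negb_and -!leNgt (ltW rM) orbT.
rewrite Rintegral_mkcond Rintegral_leb_on; last first.
  by apply: (measurable_restrictT _ _).1 => //; exact: measurable_funTS.
transitivity (\int[leb]_(x in `[t, M]) derive1 phi x).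
  rewrite Rintegral_mkcond [RHS]Rintegral_mkcond.
  apply: eq_Rintegral => x _; rewrite !patchE !mem_setE !in_itv/= andbT.
  have [xlr|xlr] := boolP (x \in `]l, r[).
    move: xlr; rewrite in_itv /= => /andP[-> xr]; rewrite xr/=.
    by rewrite (ltW (lt_trans xr rM)) andbT.
  by rewrite dphi0// !if_same.
have := @continuous_FTC2 _ (derive1 phi) phi t M tM.
rewrite /Rintegral => ->//.
- exact: continuous_subspaceT.
- split => //.
  + exact/cvg_at_right_filter/cphi.
  + exact/cvg_at_left_filter/cphi.
Qed.

Lemma integrable_derive_test phi : test_function l r phi ->
  mlr.-integrable setT (EFin \o derive1 phi).
Proof.
move=> /test_functionP[_ _ cdphi _ _].
apply/integrable_leb_on; first exact: continuous_measurable_fun.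
apply: (@integrableS _ _ _ leb `[l, r]) => //; first exact: subset_itv_oo_cc.
apply: continuous_compact_integrable; first exact: segment_compact.
exact: continuous_subspaceT.
Qed.

End interval.

(** * Primitives of square-integrable functions on an interval *)

Lemma Lfun_bounded d (T : measurableType d) (R : realType)
    (mu : {finite_measure set T -> \bar R}) (f : T -> R) (C p : R) :
  0 <= p -> measurable_fun setT f -> (forall x, `|f x| <= C) ->
  f \in Lfun mu p%:E.
Proof.
move=> p0 mf fC; rewrite inE; apply/andP; split; rewrite inE//=.
rewrite /finite_norm unlock poweR_lty//.
have iC : mu.-integrable setT (EFin \o cst (C `^ p)).
  exact: finite_measure_integrable_cst.
apply: le_lt_trans (integrable_lty measurableT iC).
apply: ge0_le_integral => //.
- by move=> x _; rewrite poweR_ge0.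
- apply/measurable_EFinP/(measurableT_comp (measurable_powR _)).
  exact: measurableT_comp.
- exact: measurable_int iC.
- by move=> x _; rewrite lee_fin ge0_ler_powR// nnegrE (le_trans _ (fC x)).
Qed.

Section primitive_on_interval.
Context {R : realType}.
Variables (l r : R).
Hypothesis lr : l < r.
Local Notation leb := (@lebesgue_measure R).
Local Notation mlr := (leb_on l r).
Local Notation T := (measurableTypeR R).
Local Notation prim := (primitive (fin_leb_on l r)).

Lemma primitive_leb_on (g : T -> R) x : measurable_fun setT g ->
  prim g x = parameterized_integral leb l x (g \_ `]l, r[).
Proof.
move=> mg; rewrite primitiveE fin_leb_onE Rintegral_leb_on; last first.
  by apply: (measurable_restrictT _ _).1 => //; exact: measurable_funTS.
rewrite /parameterized_integral Rintegral_mkcond [RHS]Rintegral_mkcond.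
apply: eq_Rintegral => t _; rewrite !patchE !mem_setE !in_itv/=.
case: (ltgtP l t) => //= [lt|_]; last by case: ifP.
by do 2 case: ifP.
Qed.

Lemma integrable_patch_itv (g : L2 l r) :
  leb.-integrable setT (EFin \o (g \_ `]l, r[)).
Proof.
have ig : leb.-integrable `]l, r[ (EFin \o g).
  by apply/integrable_leb_on => //; exact: Lfun2_integrable_leb_on.
rewrite -restrict_EFin; apply/integrable_restrict => //.
by rewrite setTI.
Qed.

Lemma within_continuous_primitive (g : L2 l r) :
  {within `[l, r], continuous (prim g)}.
Proof.
have ig : leb.-integrable `[l, r] (EFin \o (g \_ `]l, r[)).
  by apply: integrableS (integrable_patch_itv g).
have := parameterized_integral_continuous (ltW lr) ig.
by apply: subspace_eq_continuous => x _; exact/esym/primitive_leb_on.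
Qed.

(** The constant c does not contribute, as the derivative of a test function has
    integral 0 over ]l, r[. *)
Lemma weak_derivative_primitive (g : L2 l r) (c : R) :
  weak_derivative l r (fun x => prim g x + c) g.
Proof.
move=> phi tphi; have ig := Lfun2_integrable_leb_on g.
have ip := integrable_derive_test tphi.
have [cphi _ cdphi phi0 dphi0] := test_functionP tphi.
have mdphi : measurable_fun [set: T] (derive1 phi).
  exact: continuous_measurable_fun.
have int0 : \int[mlr]_x derive1 phi x = 0.
  have := Rintegral_derive_test l tphi; rewrite phi0; last first.
    by rewrite in_itv/= ltxx.
  rewrite oppr0 => <-; rewrite [RHS]Rintegral_mkcond.
  rewrite !Rintegral_leb_on//; last first.
    by apply: (measurable_restrictT _ _).1 => //; exact: measurable_funTS.
  apply: eq_Rintegral => x; rewrite inE/= in_itv/= => /andP[lx _].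
  by rewrite patchE mem_setE in_itv/= (ltW lx).
rewrite /inner; under eq_Rintegral do rewrite mulrDl.
have ipp : mlr.-integrable setT (EFin \o (fun x => prim g x * derive1 phi x)).
  apply: (le_integrable measurableT _ _
    (integrableZl measurableT (\int[mlr]_t `|g t|) ip)).
    apply/measurable_EFinP/measurable_funM => //.
    exact: (measurable_primitive (mu := fin_leb_on l r)).
  move=> x _ /=; rewrite lee_fin !normrM ler_wpM2r//.
  rewrite [leRHS]ger0_norm; last by apply: Rintegral_ge0.
  exact: (le_normr_Rintegral_setT (mu := fin_leb_on l r) (measurable_itv _) ig).
rewrite RintegralD//; last exact: (integrableZl measurableT c ip).
rewrite RintegralZl// int0 mulr0 addr0.
apply: (etrans (Rintegral_primitiveM (mu := fin_leb_on l r) ig ip)).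
transitivity (\int[mlr]_x (- 1 * (g x * phi x))).
  apply: eq_Rintegral => t _; rewrite mulN1r -mulrN; congr (_ * _).
  exact: Rintegral_derive_test.
rewrite RintegralZl ?mulN1r//.
apply/Lfun1_integrable/Lfun2_mul_Lfun1; first exact: LfunP.
apply: (Lfun_bounded (fin_leb_on l r) (C := \int[mlr]_x `|derive1 phi x|)) => //.
  exact: continuous_measurable_fun.
move=> t; rewrite -normrN -(Rintegral_derive_test t tphi).
exact: (le_normr_Rintegral_setT (mu := fin_leb_on l r) (measurable_itv _) ip).
Qed.

(** If w were nonzero at a point of ]l, r[, it would be nonzero on a ball around
    it, and a ball of positive radius is not a null set. *)
Lemma within_continuous_ae_eq0 (w : T -> R) : {within `[l, r], continuous w} ->
  w = cst 0 %[ae mlr] -> forall x, x \in `]l, r[ -> w x = 0.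
Proof.
move=> cw w0 x xlr; have [N [mN N0 wN]] := (ae_mrestr _ _ _).1 w0.
apply/eqP; apply/negPn/negP => wx0.
have /cvgrPdist_lt cwx := within_continuous_continuous lr cw xlr.
have near_w : \forall y \near x, `|w x - w y| < `|w x|.
  by apply: cwx; rewrite normr_gt0.
have near_lr : \forall y \near x, y \in `]l, r[.
  exact: near_in_itvoo.
have : \forall y \near x, N y.
  near=> y; apply: wN => /= H.
  have ylr : y \in `]l, r[ by near: y.
  have /= wy := H ylr Logic.I.
  have : `|w x - w y| < `|w x| by near: y.
  by rewrite wy subr0 ltxx.
move=> /nbhs_ballP[e /= e0 eN].
have := le_measure leb (mem_set (measurable_ball x e)) (mem_set mN) eN.
have /= -> := lebesgue_measure_ball x (ltW e0).
by rewrite /= N0 lee_fin leNgt pmulrn_lgt0 ?e0.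
Unshelve. all: by end_near. Qed.

(** By continuity the primitive is constant on ]l, r[, so its derivative is 0
    there; by Lebesgue differentiation that derivative is g almost
    everywhere. *)
Lemma primitive_ae_eq0 (g : L2 l r) (c : R) :
  (fun x => prim g x + c) = cst 0 %[ae mlr] -> g = cst 0 %[ae mlr].
Proof.
move=> pg0; pose G := g \_ `]l, r[.
have iG := integrable_patch_itv g.
have p0 x : x \in `]l, r[ -> prim g x = - c.
  move=> xlr; apply/eqP; rewrite -subr_eq0 opprK; apply/eqP.
  apply: (within_continuous_ae_eq0 (w := fun x => prim g x + c)) => // y.
  by apply: cvgD; [exact: within_continuous_primitive|exact: cvg_cst].
have iGy y : leb.-integrable `[l, y] (EFin \o G) by apply: integrableS iG.
have /= dG := FTC1 iGy (open_integrable_locally openT iG).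
apply: (ae_mrestr _ _ _).2; apply: filterS dG.
  exact: (ae_filter_ringOfSetsType leb).
move=> x /= dG xlr _.
have lx : (l%:E < x%:E)%E by move: xlr; rewrite in_itv lte_fin => /andP[].
have [_] := dG lx; rewrite /G patchE mem_set// => <-.
rewrite derive1E.
have near_p : \forall y \near x,
    \int[leb]_(t in `[l, y]) (g \_ `]l, r[) t = cst (- c) y.
  near=> y; rewrite -[LHS]primitive_leb_on// p0//.
  by near: y; exact: near_in_itvoo.
by rewrite (near_eq_derive _ near_p) derive_cst.
Unshelve. all: by end_near. Qed.

End primitive_on_interval.

(** * The inner product on L_2 *)

Section Hilbert.
Context {R : realType}.
Variables l r : R.
Local Notation mlr := (leb_on l r).
Implicit Types f g h : L2 l r.

Lemma integrable_inner f g : mlr.-integrable setT (EFin \o (fun x => f x * g x)).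
Proof. by apply/Lfun1_integrable/Lfun2_mul_Lfun1; exact: LfunP. Qed.

Lemma innerC f g : inner l r f g = inner l r g f.
Proof. by apply: eq_Rintegral => x _; rewrite mulrC. Qed.

Lemma innerDl f g h : inner l r (f + g) h = inner l r f h + inner l r g h.
Proof.
rewrite /inner -RintegralD//; [|exact: integrable_inner..].
by apply: eq_Rintegral => x _; rewrite -mulrDl.
Qed.

Lemma innerZl a f g : inner l r (a *: f) g = a * inner l r f g.
Proof.
rewrite /inner -RintegralZl//; last exact: integrable_inner.
by apply: eq_Rintegral => x _; rewrite mulrA.
Qed.

Lemma inner_ge0 f : 0 <= inner l r f f.
Proof. by apply: Rintegral_ge0 => x _; rewrite -expr2 sqr_ge0. Qed.

Lemma inner_eq0 f : f = cst 0 %[ae mlr] -> inner l r f f = 0.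
Proof.
move=> f0; rewrite /inner /Rintegral.
rewrite (ae_eq_integral (cst 0%E))//; first by rewrite integral0.
- exact: measurable_int (integrable_inner f f).
- by apply: filterS f0 => x /= /(_ I) ->; rewrite mul0r.
Qed.

Lemma sqr_normL2 f : normL2 l r f ^+ 2 = inner l r f f.
Proof. by rewrite sqr_sqrtr// inner_ge0. Qed.

Lemma normL2_eq0 f : (normL2 l r f == 0) = (inner l r f f == 0).
Proof. by rewrite -sqr_normL2 sqrf_eq0. Qed.

Lemma normL2Z a f : normL2 l r (a *: f) = `|a| * normL2 l r f.
Proof.
rewrite /normL2 innerZl innerC innerZl mulrA -expr2.
by rewrite sqrtrM ?sqr_ge0// sqrtr_sqr.
Qed.

Lemma normL2B f g : normL2 l r (f - g) = normL2 l r (g - f).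
Proof. by rewrite -opprB -scaleN1r normL2Z normrN1 mul1r. Qed.

Lemma cauchy_schwarz f g : `|inner l r f g| <= normL2 l r f * normL2 l r g.
Proof.
set A := inner l r f f; set B := inner l r f g; set C := inner l r g g.
have pos a b : 0 <= a ^+ 2 * A + 2 * a * b * B + b ^+ 2 * C.
  have := inner_ge0 (a *: f + b *: g).
  rewrite innerDl !innerZl (innerC f) (innerC g) !innerDl !innerZl.
  rewrite (innerC g f) -/A -/C -/B => H; lra.
have A0 : 0 <= A := inner_ge0 f.
have C0 : 0 <= C := inner_ge0 g.
have BAC : B ^+ 2 <= A * C.
  (* If C = 0, the pair (B, - (A + 1)) in pos gives - B^2 (A + 2) >= 0, which
     forces B = 0; otherwise the pair (C, - B) gives C (A C - B^2) >= 0. *)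
  have [C0'|Cn0] := eqVneq C 0.
    have := pos B (- (A + 1)); rewrite C0' mulr0 addr0 => H.
    nra.
  have Cp : 0 < C by rewrite lt_neqAle eq_sym Cn0.
  have := pos C (- B) => H.
  rewrite -(ler_pM2l Cp) -subr_ge0.
  lra.
rewrite /normL2 -sqrtrM// -sqrtr_sqr.
exact: ler_wsqrtr.
Qed.

End Hilbert.

(** * The dual norm of the residual *)

(** Every g in L_2 is the gradient of an H^1 function that vanishes at a
    prescribed point; the last clause makes that function a legitimate
    competitor in the supremum as soon as g is nonzero. *)
Lemma H1_primitive (R : realType) (l r : R) (lr : l < r) (g : L2 l r)
  (x0 : R) : exists v : H1 l r,
  [/\ grad v = g, has_trace l r v x0 0
    & v = cst 0 %[ae leb_on l r] -> g = cst 0 %[ae leb_on l r]].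
Proof.
pose p := primitive (fin_leb_on l r) g; pose c := - p x0.
have ig := Lfun2_integrable_leb_on g.
have vL2 : (fun x => p x + c) \in Lfun (leb_on l r) 2%:E.
  apply: (Lfun_bounded (fin_leb_on l r)
    (C := \int[leb_on l r]_t `|g t| + `|c|)) => //.
    apply: measurable_funD => //.
    exact: (measurable_primitive (mu := fin_leb_on l r)).
  move=> x; rewrite (le_trans (ler_normD _ _))// lerD2r.
  exact: (le_normr_Rintegral_setT (mu := fin_leb_on l r) (measurable_itv _) ig).
exists (@MkH1 _ l r (Lfun_Sub (lee1n 2) vL2) g (weak_derivative_primitive g c)).
split => //=.
  exists (fun x => p x + c); split; last by rewrite /c subrr.
  - by move=> x; apply: cvgD; [exact: within_continuous_primitive|exact: cvg_cst].
  - exact: aeW.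
exact: (primitive_ae_eq0 lr).
Qed.

Theorem theorem2p1 (R : realType) (l r : R) (hlr : l < r) (b : R) (hb : b != 0)
    (f u : L2 l r) (hu : ultra_weak_solution b f u) :
  forall uh : L2 l r,
    (normL2 l r (u - uh))%:E = scaled_dual_norm b (residual b f uh).
Proof.
move=> uh; pose e : L2 l r := uh - u.
have resE v : H1_plus b v -> residual b f uh v = inner l r e (b *: grad v).
  move=> /hu; rewrite /residual => <-.
  by rewrite /e -(scaleN1r u) innerDl innerZl mulN1r addrC.
rewrite normL2B -/e; apply/eqP; rewrite eq_le; apply/andP; split; last first.
  apply: ge_ereal_sup => _ [v [bv _] <-]; rewrite lee_fin resE//.
  have [->|n0] := eqVneq (normL2 l r (b *: grad v)) 0.
    by rewrite invr0 mulr0 sqrtr_ge0.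
  rewrite ler_pdivrMr ?lt_neqAle 1?eq_sym ?n0 ?sqrtr_ge0//.
  exact: le_trans (ler_norm _) (cauchy_schwarz _ _).
have [h [h0 eh]] : exists h : L2 l r, normL2 l r h != 0 /\
    inner l r e h / normL2 l r h = normL2 l r e.
  (* If e has norm 0, any h of nonzero norm will do; h = 1 is such an h. *)
  have [e0|e0] := eqVneq (normL2 l r e) 0; last first.
    by exists e; split => //; rewrite -sqr_normL2 expr2 mulfK.
  pose one : L2 l r := Lfun_Sub (lee1n 2) (Lfun_cst (fin_leb_on l r) 1 2).
  exists one; split.
    rewrite normL2_eq0 /inner.
    under eq_Rintegral do rewrite /= mulr1.
    rewrite Rintegral_cst// mul1r /= /mrestr setTI.
    rewrite lebesgue_measure_itv/= lte_fin hlr /= subr_eq0.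
    by rewrite gt_eqF.
  have := cauchy_schwarz e one.
  by rewrite e0 mul0r normr_le0 => /eqP ->; rewrite mul0r.
(* The outflow point is r if b > 0 and l if b < 0. *)
have [v [gv tv v0]] := H1_primitive hlr (b^-1 *: h) (if 0 < b then r else l).
have bgv : b *: grad v = h by rewrite gv scalerA divff// scale1r.
have bv : H1_plus b v.
  move=> x [[->|->]]; rewrite /normal.
    by rewrite eqxx mulrN1 oppr_gt0 => b0; move: tv; rewrite ltNge (ltW b0).
  by rewrite gt_eqF// mulr1 => b0; move: tv; rewrite b0.
apply: ereal_sup_ubound; exists v; last by rewrite resE// bgv eh.
split => // /v0 /inner_eq0 /eqP; rewrite -normL2_eq0 normL2Z mulf_eq0.
by rewrite (negbTE h0) orbF normr_eq0 invr_eq0 (negbTE hb).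
Qed.
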